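(* Every crossing tournament admits a numbering such that its backedge graph is a circle graph, and for every vertex, the set of its right in-neighbours is transitive, and the set of its left out-neighbours is transitive; and consequently the numbering has local chromatic number at most two.
   Context: All tournaments are finite. The chromatic number of a tournament $T$ is the minimum $k$ such that $V(T)$ is the union of $k$ sets each inducing an acyclic (transitive) subtournament; a set of vertices is transitive if it induces a transitive (acyclic) subtournament. Fix a numbering $v_1,\ldots,v_n$ of $V(T)$. The backedge graph is the graph with vertex set $V(T)$ in which, for $i<j$, $v_i$ and $v_j$ are adjacent if and only if the edge between them is directed from $v_j$ to $v_i$. A vertex $v_j$ is a right in-neighbour of $v_i$ if $j>i$ and the edge between them is directed from $v_j$ to $v_i$; it is a left out-neighbour of $v_i$ if $j<i$ and the edge between them is directed from $v_i$ to $v_j$. The local chromatic number of the numbering is the maximum over $i$ of the chromatic number of the subtournament induced on the set of all $v_j$ that are left out-neighbours or right in-neighbours of $v_i$. An integer matching is a finite set $P$ of pairs $(a,b)$ of integers with $a<b$, such that all the integers used in pairs of $P$ are distinct. The graph with vertex set $P$ in which $(a,b)$ and $(c,d)$ are adjacent if either $a<c<b<d$ or $c<a<d<b$ is called a circle graph. The crossing tournament defined by $P$ is the tournament with vertex set $P$ in which, for distinct $(a,b),(c,d)\in P$, the edge is directed from $(a,b)$ to $(c,d)$ if either $a<b<c<d$, or $c<a<b<d$, or $c<a<d<b$. A crossing tournament is a tournament arising in this way. *)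

(* Defs.v *)
From mathcomp Require Import all_boot all_order all_algebra finmap zify.

Set Implicit Arguments.
Unset Strict Implicit.
Unset Printing Implicit Defensive.

Import Order.TTheory GRing.Theory Num.Theory.

Record tournament := Tournament {
  vertex :> finType;
  edge : rel vertex;
  edge_irr : irreflexive edge;
  edge_tot : forall x y, x != y -> edge x y (+) edge y x
}.

Definition tournament_iso (T U : tournament) : Prop :=
  exists2 f : T -> U, bijective f & forall x y, edge (f x) (f y) = edge x y.

Section Induced.
Variables (T : tournament) (A : {set T}).

Definition induced_edge : rel {x : T | x \in A} :=
  fun x y => edge (val x) (val y).

Lemma induced_edge_irr : irreflexive induced_edge.
Proof. by move=> x; apply: edge_irr. Qed.

Lemma induced_edge_tot x y : x != y -> induced_edge x y (+) induced_edge y x.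
Proof. by move=> xy; apply: edge_tot. Qed.

Definition induced : tournament :=
  Tournament induced_edge_irr induced_edge_tot.

End Induced.

(* For a tournament, transitivity of the edge relation is equivalent to the
   absence of directed cycles. *)
Definition is_transitive (T : tournament) : bool :=
  [forall x : T, forall y : T, forall z : T,
     edge x y ==> edge y z ==> edge x z].

Definition transitive_set (T : tournament) (A : {set T}) : bool :=
  is_transitive (induced A).

Definition covered_by (T : tournament) (k : nat) : bool :=
  [exists C : {ffun 'I_k -> {set T}},
     (\bigcup_(i < k) C i == [set: T]) && [forall i, transitive_set (C i)]].

Lemma covered_by_ex (T : tournament) : exists k, covered_by T k.
Proof.
exists #|T|; apply/existsP; exists [ffun i => [set enum_val i]].
apply/andP; split.
  rewrite -subTset; apply/subsetP => x _; apply/bigcupP.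
  by exists (enum_rank x); rewrite ?ffunE ?enum_rankK ?set11.
apply/forallP => i; rewrite ffunE.
apply/forallP => -[x xi]; apply/forallP => -[y yi]; apply/forallP => z.
have ex := set1P xi; have ey := set1P yi.
by rewrite /= /induced_edge /= ex ey edge_irr.
Qed.

Definition chromatic_number (T : tournament) : nat := ex_minn (covered_by_ex T).

(* A numbering v_1, ..., v_n of V(T) is given by the bijection pos sending each
   vertex to its (zero-based) index. *)
Section Numbering.
Variables (T : tournament) (pos : T -> 'I_#|T|).

Definition backedge : rel T := fun x y =>
  ((pos x < pos y)%N && edge y x) || ((pos y < pos x)%N && edge x y).

Definition right_in (x : T) : {set T} := [set y | (pos x < pos y)%N & edge y x].

Definition left_out (x : T) : {set T} := [set y | (pos y < pos x)%N & edge x y].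

Definition local_chromatic_number : nat :=
  \max_(x : T) chromatic_number (induced (left_out x :|: right_in x)).

End Numbering.

Definition integer_matching (P : {fset int * int}) : bool :=
  all (fun p => p.1 < p.2)%R P &&
  uniq (flatten [seq [:: p.1; p.2] | p <- enum_fset P]).

Definition circle_adj (p q : int * int) : bool :=
  let: (a, b) := p in let: (c, d) := q in
  [&& a < c, c < b & b < d]%R || [&& c < a, a < d & d < b]%R.

Definition is_circle_graph (V : finType) (adj : rel V) : Prop :=
  exists2 P : {fset int * int}, integer_matching P &
  exists2 f : V -> P, bijective f &
    forall x y, adj x y = circle_adj (val (f x)) (val (f y)).

(* Never holds when p = q, so distinctness need not be required separately. *)
Definition crossing_edge (p q : int * int) : bool :=
  let: (a, b) := p in let: (c, d) := q in
  [|| [&& a < b, b < c & c < d]%R,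
      [&& c < a, a < b & b < d]%R
    | [&& c < a, a < d & d < b]%R].

Section CrossingTournament.
Variables (P : {fset int * int}) (matchP : integer_matching P).

Lemma crossing_edge_irr : irreflexive (fun x y : P => crossing_edge (val x) (val y)).
Proof. by case=> -[a b] /= _; lia. Qed.

Lemma uniq_flatten_disjoint (s : seq (int * int)) p q :
  uniq (flatten [seq [:: r.1; r.2] | r <- s]) -> p \in s -> q \in s -> p != q ->
  [&& p.1 != q.1, p.1 != q.2, p.2 != q.1 & p.2 != q.2].
Proof.
have mem r t : r \in t -> (r.1 \in flatten [seq [:: r.1; r.2] | r <- t]) &&
                          (r.2 \in flatten [seq [:: r.1; r.2] | r <- t]).
  by move=> rt; apply/andP; split; apply/flattenP; exists [:: r.1; r.2];
     rewrite ?inE ?eqxx ?orbT //; apply: (map_f (fun r => [:: r.1; r.2])).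
elim: s => [//|r s IH] /= /andP[]; rewrite inE negb_or.
move=> /andP[_ r1] /andP[r2 us]; rewrite !inE.
have ne t : t \in s -> [&& r.1 != t.1, r.1 != t.2, r.2 != t.1 & r.2 != t.2].
  move=> /mem /andP[t1 t2].
  by apply/and4P; split; apply/eqP => E; move: r1 r2; rewrite E ?t1 ?t2.
case/predU1P => [->|ps]; case/predU1P => [->|qs]; rewrite ?eqxx // => npq.
- exact: ne.
- by case/and4P: (ne _ ps) => *; apply/and4P; split; rewrite eq_sym.
- exact: IH.
Qed.

Lemma crossing_edge_tot (x y : P) :
  x != y -> crossing_edge (val x) (val y) (+) crossing_edge (val y) (val x).
Proof.
case/andP: matchP => /allP lt1 un nxy.
have := uniq_flatten_disjoint un (valP x) (valP y) nxy.
have := lt1 _ (valP x); have := lt1 _ (valP y).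
case: (val x) (val y) => [a b] [c d] /=; lia.
Qed.

Definition crossing_tournament : tournament :=
  Tournament crossing_edge_irr crossing_edge_tot.

End CrossingTournament.

Definition is_crossing_tournament (T : tournament) : Prop :=
  exists (P : {fset int * int}) (matchP : integer_matching P),
    tournament_iso T (crossing_tournament matchP).

(* Main.v *)
Require Import Defs.
From mathcomp Require Import all_boot all_order all_algebra finmap.
From mathcomp Require Import zify.

Set Implicit Arguments.
Unset Strict Implicit.
Unset Printing Implicit Defensive.

(** Number the pairs (a, b) by increasing b. Disjoint pairs and nested pairs
    then give forward edges and crossing pairs give backedges, so the backedge
    graph is the circle graph of the same matching. The right in-neighbours of
    (a, b) all straddle b, and its left out-neighbours all straddle a; among
    pairs straddling a common point, edges go from the larger first entry to
    the smaller one, whether the pairs cross or are nested. *)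

(** The position of [x] is the number of elements with a smaller [r]-value; it grows strictly with
    [r x], since [x] itself joins the count for any larger value. *)
Lemma numbering_by (T : finType) (r : T -> int) : injective r ->
  exists2 pos : T -> 'I_#|T|, bijective pos &
    forall x y, (pos x < pos y)%N = (r x < r y)%R.
Proof.
move=> r_inj; pose below x := [set y | (r y < r x)%R].
have below_lt x : (#|below x| < #|T|)%N.
  rewrite -cardsT; apply: proper_card; apply/properP; split.
    exact: subsetT.
  by exists x; rewrite !inE //; lia.
have below_mono x y : (r x < r y)%R -> (#|below x| < #|below y|)%N.
  move=> xy; apply: proper_card; apply/properP; split.
    by apply/subsetP => z; rewrite !inE; lia.
  by exists x; rewrite !inE //; lia.
have pos_lt x y : (#|below x| < #|below y|)%N = (r x < r y)%R.
  apply/idP/idP => [lt_xy|]; last exact: below_mono.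
  have [//|yx|/r_inj exy] := Order.TotalTheory.ltgtP (r x) (r y).
    by have := below_mono _ _ yx; lia.
  by move: lt_xy; rewrite exy ltnn.
exists (fun x => Ordinal (below_lt x)) => //.
apply: inj_card_bij; last by rewrite card_ord.
move=> x y /(congr1 val) /= exy; apply: r_inj.
have := pos_lt x y; have := pos_lt y x; rewrite exy ltnn; lia.
Qed.

(** Moving the quantifiers from the subtype to [T] lets transitivity pass to copies of [A] inside a
    larger induced subtournament. *)
Lemma transitive_setP (T : tournament) (A : {set T}) :
  reflect {in A & &, transitive (@edge T)} (transitive_set A).
Proof.
apply: (iffP idP) => [trA y x z yA xA zA xy yz | trA].
  by have /forallP/(_ (exist _ x xA))/forallP/(_ (exist _ y yA)) := trA;
     move=> /forallP/(_ (exist _ z zA)); rewrite /= /induced_edge /= xy yz.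
apply/forallP => -[x xA]; apply/forallP => -[y yA]; apply/forallP => -[z zA].
apply/implyP => xy; apply/implyP => yz; exact: trA xy yz.
Qed.

Lemma transitive_set_key (T : tournament) (A : {set T}) (h : T -> int) :
  {in A &, forall x y, edge x y = (h y < h x)%R} -> transitive_set A.
Proof.
move=> hE; apply/transitive_setP => y x z yA xA zA.
by rewrite !hE //; lia.
Qed.

(** Colour classes may overlap, so the traces of [A] and [B] on the union already form a cover by
    two transitive sets. *)
Lemma chromatic_number_setU (T : tournament) (A B : {set T}) :
  transitive_set A -> transitive_set B ->
  (chromatic_number (induced (A :|: B)) <= 2)%N.
Proof.
move=> /transitive_setP trA /transitive_setP trB.
rewrite /chromatic_number; case: ex_minnP => k _; apply.
pose restr (C : {set T}) : {set induced (A :|: B)} := [set x | val x \in C].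
apply/existsP; exists [ffun i : 'I_2 => restr (if i == ord0 then A else B)].
apply/andP; split.
  rewrite -subTset; apply/subsetP => x _; apply/bigcupP.
  have /setUP[xA|xB] := valP x.
    by exists ord0; rewrite // ffunE inE.
  by exists ord_max; rewrite // ffunE inE.
apply/forallP => i; apply/transitive_setP => y x z; rewrite ffunE !inE.
by case: (i == ord0); [apply: trA | apply: trB].
Qed.

Theorem mainTheorem8 (T : tournament) (hT : is_crossing_tournament T) :
  exists pos : T -> 'I_#|T|,
    [/\ bijective pos,
        is_circle_graph (backedge pos),
        (forall x : T, transitive_set (right_in pos x)),
        (forall x : T, transitive_set (left_out pos x))
      & (local_chromatic_number pos <= 2)%N].
Proof.
have [P [matchP [f f_bij f_edge]]] := hT.
pose l x := (val (f x)).1; pose r x := (val (f x)).2.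
have [/allP ordP uniqP] := andP matchP.
have lr x : (l x < r x)%R by apply: ordP; apply: valP.
have distinct x y : x != y ->
    [&& l x != l y, l x != r y, r x != l y & r x != r y].
  move=> xy; apply: (uniq_flatten_disjoint uniqP); try exact: valP.
  by rewrite (inj_eq val_inj) (bij_eq f_bij).
have edgeE x y : edge x y = [|| r x < l y, (l y < l x) && (r x < r y)
                               | [&& l y < l x, l x < r y & r y < r x]]%R.
  rewrite -f_edge.
  change (edge (f x) (f y)) with (crossing_edge (val (f x)) (val (f y))).
  move: (lr x) (lr y); rewrite /l /r.
  by case: (val (f x)) (val (f y)) => [a b] [c d] /=; lia.
have r_inj : injective r.
  move=> x y exy; apply/eqP; apply/negPn/negP => /distinct.
  by rewrite exy eqxx !andbF.
have [pos pos_bij pos_lt] := numbering_by r_inj.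
(* Two pairs around [m] cannot be disjoint, as [l y <= m <= r x]; in the two remaining cases of
   [edgeE] the edge is decided by [l] alone. *)
have straddle (A : {set T}) (m : int) :
    {in A, forall x, l x <= m <= r x}%R -> transitive_set A.
  move=> mA; apply: (transitive_set_key (h := l)) => x y /mA mx /mA my.
  have [->|/distinct] := eqVneq x y; first by rewrite edge_irr; lia.
  by rewrite edgeE; lia.
have tr_right x : transitive_set (right_in pos x).
  apply: (straddle _ (r x)) => y; rewrite inE pos_lt edgeE.
  by move: (lr x) (lr y); lia.
have tr_left x : transitive_set (left_out pos x).
  apply: (straddle _ (l x)) => y; rewrite inE pos_lt edgeE.
  by move: (lr x) (lr y); lia.
exists pos; split=> //.
(* The matching [P] itself represents the backedge graph: of the cases of [edgeE], only the crossing
   one points from larger to smaller [r]. *)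
- exists P => //; exists f => // x y.
  rewrite /backedge !pos_lt !edgeE.
  have -> : circle_adj (val (f x)) (val (f y)) =
      ([&& l x < l y, l y < r x & r x < r y]
       || [&& l y < l x, l x < r y & r y < r x])%R.
    by rewrite /l /r; case: (val (f x)) (val (f y)) => [a b] [c d].
  have [->|/distinct] := eqVneq x y; first by lia.
  by move: (lr x) (lr y); lia.
- by apply/bigmax_leqP => x _; apply: chromatic_number_setU.
Qed.
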